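(* For $n,a\in\mathbb{N}$ with $n\ge 1$ and $1\le a\le n+1$: $$\begin{aligned}[F_{n+1}]_{q} ={}& [F_{n-a+2}]_{q^{F_{a}}}\,[F_{a}]_{q}\\ &+[F_{a}]_{q}\sum_{i=1}^{\lfloor n/a\rfloor-1}\left\{ q^{F_{a}\sum_{j=1}^{i} F_{n-ja+2}}\left(\prod_{j=1}^{i}[F_{a-1}]_{q^{F_{n-ja+1}}}\right)[F_{n-(i+1)a+2}]_{q^{F_{a}}}\right\}\\ &+ q^{F_{a}\sum_{j=1}^{\lfloor n/a\rfloor} F_{n-ja+2}}\left(\prod_{j=1}^{\lfloor n/a\rfloor}[F_{a-1}]_{q^{F_{n-ja+1}}}\right)\left[F_{n-\lfloor n/a\rfloor a+1}\right]_{q}.\end{aligned}$$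
   Context: The Fibonacci numbers are defined by $F_0=0$, $F_1=1$, $F_n=F_{n-1}+F_{n-2}$. The $q$-analogue of the $n$-th Fibonacci number is $[F_n]_q=\sum_{i=0}^{F_n-1}q^i$ (so $[F_0]_q=0$), where $q$ is an indeterminate; $[F_n]_{q^s}=\sum_{i=0}^{F_n-1}q^{si}$ denotes the same expression with $q$ replaced by $q^s$. The symbol $\lfloor x\rfloor$ denotes the greatest integer not exceeding $x$.
   Formalization: For a = n+1 the middle sum runs from i = 1 to −1; read as an empty sum it makes the right side 2[F_{n+1}]_q, so the identity fails. It is proved with the signed convention (the sum is minus its i = 0 term); for a ≤ n it is as printed. *)

(* Defs.v *)
From mathcomp Require Import all_boot all_order all_algebra.

Set Implicit Arguments.
Unset Strict Implicit.
Unset Printing Implicit Defensive.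

Import GRing.Theory.
Local Open Scope ring_scope.

Fixpoint fib (n : nat) : nat :=
  match n with
  | 0 => 0
  | 1 => 1
  | (m.+1 as k).+1 => fib k + fib m
  end%N.

(* [F_n]_q; substituting q ^+ s for the indeterminate q gives [F_n]_{q^s}. *)
Definition qfib (q : {poly int}) (n : nat) : {poly int} :=
  \sum_(0 <= i < fib n) q ^+ i.

(* The sum of f i for i from m to k - 1, with the usual signed convention
   when k < m (so that osum m k f + osum k l f = osum m l f always holds);
   the library's own range sums are 0 there. For m <= k it is the ordinary
   sum. The reversed case occurs only for a = n + 1, where a sum from i = 1 to
   floor(n / a) - 1 = -1 appears: osum 1 0 f = - f 0, the reading under which
   the identity holds there (with 0 instead, its right-hand side would be
   2 [F_(n+1)]_q). *)
Definition osum (m k : nat) (f : nat -> {poly int}) : {poly int} :=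
  \sum_(m <= i < k) f i - \sum_(k <= i < m) f i.

(* Main.v *)
Require Import Defs.
From mathcomp Require Import all_boot all_order all_algebra.
From mathcomp Require Import ring zify.

Import GRing.Theory.
Local Open Scope ring_scope.

(** Cutting the range of exponents of [F_(m+1)]_q along
    F_(m+1) = F_a F_(m-a+2) + F_(a-1) F_(m-a+1) gives
      [F_(m+1)]_q = [F_a]_q [F_(m-a+2)]_(q^F_a)
        + q^(F_a F_(m-a+2)) [F_(a-1)]_(q^F_(m-a+1)) [F_(m-a+1)]_q,
    and the last factor has the same shape with m replaced by m - a. Starting
    from m = n, this can be repeated floor(n / a) times. *)

Lemma fibSS (n : nat) : fib n.+2 = (fib n.+1 + fib n)%N.
Proof. by []. Qed.

Lemma fib_addS (m n : nat) :
  fib (m + n).+1 = (fib m.+1 * fib n.+1 + fib m * fib n)%N.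
Proof.
elim: m n => [|m IHm] n; first by rewrite mul1n mul0n addn0.
by rewrite addSnnS IHm !fibSS; ring.
Qed.

Section GeometricSums.

Variable R : comNzRingType.
Implicit Types (q : R) (m n : nat).

Lemma sum_expr_add q m n :
  \sum_(0 <= i < m + n) q ^+ i =
    \sum_(0 <= i < m) q ^+ i + q ^+ m * \sum_(0 <= i < n) q ^+ i.
Proof.
elim: n => [|n IHn]; first by rewrite addn0 [X in _ * X]big_geq // mulr0 addr0.
by rewrite addnS !big_nat_recr //= IHn mulrDr exprD addrA.
Qed.

(** Division by [m] writes each exponent below [m * n] uniquely as r + m s with r < m and s < n. *)
Lemma sum_expr_mul q m n :
  \sum_(0 <= i < m * n) q ^+ i =
    (\sum_(0 <= i < m) q ^+ i) * \sum_(0 <= i < n) (q ^+ m) ^+ i.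
Proof.
elim: n => [|n IHn]; first by rewrite muln0 big_geq // [X in _ * X]big_geq // mulr0.
by rewrite mulnS addnC sum_expr_add big_nat_recr //= IHn -exprM; ring.
Qed.

End GeometricSums.

Lemma qfib_add (q : {poly int}) (a b : nat) :
  qfib q (a.+1 + b.+1) =
    qfib q a.+1 * qfib (q ^+ fib a.+1) b.+2
    + q ^+ (fib a.+1 * fib b.+2) * qfib (q ^+ fib b.+1) a * qfib q b.+1.
Proof.
(* [mulnC] makes the upper block [fib a] runs of length [fib b.+1], hence the base [q ^+ fib b.+1]
   under index [a]. *)
rewrite /qfib addSn fib_addS (mulnC (fib a)) sum_expr_add !sum_expr_mul.
by ring.
Qed.

(** For [k = 0] the signed sum is [- f 0] and cancels the leading term; this covers the case a = n +
    1. *)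
Lemma osum_recl (k : nat) (f : nat -> {poly int}) :
  f 0 + osum 1 k f = \sum_(0 <= i < k) f i.
Proof.
rewrite /osum; case: k => [|k].
  by rewrite big_nat1 !big_geq // sub0r subrr.
by rewrite [X in _ - X]big_geq // subr0 [in RHS]big_ltn.
Qed.

(** [P i] is the factor in front of the remainder after [i] cuts. As [P 0] is 1, the first cut is
    the summand of index 0 and needs no separate treatment. *)
Lemma qfib_iter (q : {poly int}) (n a k : nat) :
  (0 < a)%N -> (k * a <= n)%N ->
  let P i := q ^+ (fib a * \sum_(1 <= j < i.+1) fib (n + 2 - j * a))
             * \prod_(1 <= j < i.+1)
                 qfib (q ^+ fib (n + 1 - j * a)) (a - 1) in
  qfib q (n + 1) =
    qfib q a *
      (\sum_(0 <= i < k) P i * qfib (q ^+ fib a) (n + 2 - i.+1 * a))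
    + P k * qfib q (n + 1 - k * a).
Proof.
move=> a_gt0 + P; elim: k => [|k IHk] kan.
  rewrite big_geq // mulr0 add0r /P !(big_geq (leqnn 1)).
  by rewrite muln0 expr0 !mul1r mul0n subn0.
rewrite IHk; last by lia.
have PS : P k.+1 = P k * (q ^+ (fib a * fib (n + 2 - k.+1 * a))
                          * qfib (q ^+ fib (n + 1 - k.+1 * a)) (a - 1)).
  rewrite /P (big_nat_recr k.+1) //= (big_nat_recr k.+1) //=.
  by rewrite mulnDr exprD; ring.
rewrite PS big_nat_recr //=.
case: a a_gt0 kan {IHk PS} @P => // a _ kan P.
(* The bound [kan] keeps these subtractions from truncating, so [qfib_add] can cut the remainder
   once more. *)
have -> : (n + 1 - k * a.+1 = a.+1 + (n - k.+1 * a.+1).+1)%N by lia.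
have -> : (n + 1 - k.+1 * a.+1 = (n - k.+1 * a.+1).+1)%N by lia.
have -> : (n + 2 - k.+1 * a.+1 = (n - k.+1 * a.+1).+2)%N by lia.
by rewrite qfib_add subn1 /=; ring.
Qed.

Theorem proposition2p6 (n a : nat) (hn : (1 <= n)%N)
    (ha1 : (1 <= a)%N) (han : (a <= n.+1)%N) :
  let q : {poly int} := 'X in
  let N := (n %/ a)%N in
  qfib q (n + 1) =
    qfib (q ^+ fib a) (n + 2 - a) * qfib q a
    + qfib q a *
        osum 1 N (fun i =>
          q ^+ (fib a * \sum_(1 <= j < i.+1) fib (n + 2 - j * a))
          * (\prod_(1 <= j < i.+1)
               qfib (q ^+ fib (n + 1 - j * a)) (a - 1))
          * qfib (q ^+ fib a) (n + 2 - i.+1 * a))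
    + q ^+ (fib a * \sum_(1 <= j < N.+1) fib (n + 2 - j * a))
      * (\prod_(1 <= j < N.+1)
           qfib (q ^+ fib (n + 1 - j * a)) (a - 1))
      * qfib q (n + 1 - N * a).
Proof.
move=> q N; rewrite {1}(qfib_iter q n a N ha1 (leq_trunc_div n a)) /=.
(* The summand of index 0 becomes the isolated first term of the statement. *)
congr (_ + _); rewrite -osum_recl mulrDr; congr (_ + _).
rewrite !(big_geq (leqnn 1)) muln0 expr0 !mul1r mul1n.
exact: mulrC.
Qed.
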